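(* Let $\Bbbk$ be a commutative ring, $M$ a $\Bbbk$-module and $\Phi:M\times M\to\Bbbk$ a bilinear form with $\Phi(x,x)=0$ for all $x$ (not necessarily nondegenerate). If $M$ is flat over $\Bbbk$, then the canonical surjections $\phi^n:S^n(M)\to SW_n(M)/SW_{n-1}(M)$ are isomorphisms for all $n\ge0$, hence so is $\phi:S(M)\to\operatorname{gr}_F SW(M)$.
   Context: The symplectic Weyl algebra is $SW(M)=SW(M,\Phi):=T(M)/I_\Phi$, where $T(M)=\bigoplus_{n\ge0}M^{\otimes n}$ and $I_\Phi$ is the two-sided ideal generated by $x\otimes y-y\otimes x-\Phi(x,y)\cdot1$ for $x,y\in M$. Its filtration is $SW_n(M):=$ image of $\bigoplus_{m\le n}M^{\otimes m}$ (with $SW_{-1}=0$), and $\operatorname{gr}_F SW(M)=\bigoplus_n SW_n/SW_{n-1}$. The map $\phi^n$ sends $x_1\cdots x_n\in S^n(M)$ to the class of the product of the images of $x_1,\dots,x_n$ in $SW_n(M)$; it is well defined because these images commute modulo $SW_{n-1}(M)$. *)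

(* Defs.v *)
From HB Require Import structures.
From mathcomp Require Import all_boot all_order all_algebra.
Set Implicit Arguments. Unset Strict Implicit. Unset Printing Implicit Defensive.
Import Order.TTheory GRing.Theory Num.Theory.
Local Open Scope ring_scope.

(* Free R-modules are modelled as R-valued functions on a set X of basis
   symbols; a submodule given by generators is described by [in_span]
   (finite R-linear combinations of generators).  Quotient modules are
   described through membership in the submodule of relations. *)

Definition delta (R : pzRingType) (X : eqType) (x : X) : X -> R :=
  fun y => (y == x)%:R.

Definition in_span (R : pzRingType) (X : Type) (G : (X -> R) -> Prop)
    (c : X -> R) : Prop :=
  exists k (a : 'I_k -> R) (g : 'I_k -> X -> R),
    (forall i, G (g i)) /\ (forall x, c x = \sum_(i < k) a i * g i x).

Definition comb (R : pzRingType) (X : eqType) k (a : 'I_k -> R) (p : 'I_k -> X)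
  : X -> R := fun x => \sum_(i < k) a i * delta R (p i) x.

(* Tensor product N (x) M = F(N * M) / (bilinearity relations). *)
Definition bil_rel (R : comPzRingType) (N M : lmodType R)
    (g : N * M -> R) : Prop :=
  (exists (n n' : N) (m : M), g =1 fun z =>
      delta R (n + n', m) z - delta R (n, m) z - delta R (n', m) z)
  \/ (exists (n : N) (m m' : M), g =1 fun z =>
      delta R (n, m + m') z - delta R (n, m) z - delta R (n, m') z)
  \/ (exists (r : R) (n : N) (m : M), g =1 fun z =>
      delta R (r *: n, m) z - r * delta R (n, m) z)
  \/ (exists (r : R) (n : N) (m : M), g =1 fun z =>
      delta R (n, r *: m) z - r * delta R (n, m) z).

(* M is flat: for every injective linear f : N1 -> N2 the induced map
   f (x) id : N1 (x) M -> N2 (x) M is injective. *)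
Definition flat (R : comPzRingType) (M : lmodType R) : Prop :=
  forall (N1 N2 : lmodType R) (f : {linear N1 -> N2}), injective f ->
  forall k (a : 'I_k -> R) (p : 'I_k -> N1 * M),
    in_span (@bil_rel R N2 M) (comb a (fun i => (f (p i).1, (p i).2))) ->
    in_span (@bil_rel R N1 M) (comb a p).

(* T(M) = F(seq M) / (multilinearity relations in each tensor slot);
   the words u ++ x :: v are the pure tensors. *)
Definition tensor_rel (R : comPzRingType) (M : lmodType R)
    (P : seq M -> seq M -> Prop) (g : seq M -> R) : Prop :=
  (exists (u v : seq M) (x y : M), P u v /\ g =1 fun w =>
      delta R (u ++ (x + y) :: v) w - delta R (u ++ x :: v) w
      - delta R (u ++ y :: v) w)
  \/ (exists (u v : seq M) (r : R) (x : M), P u v /\ g =1 fun w =>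
      delta R (u ++ (r *: x) :: v) w - r * delta R (u ++ x :: v) w).

(* Relations defining SW(M) = T(M)/I_Phi, as a quotient of F(seq M):
   multilinearity, together with u (x y - y x - Phi(x,y)) v. *)
Definition weyl_rel (R : comPzRingType) (M : lmodType R) (Phi : M -> M -> R)
    (g : seq M -> R) : Prop :=
  tensor_rel (fun _ _ => True) g
  \/ (exists (u v : seq M) (x y : M), g =1 fun w =>
      delta R (u ++ x :: y :: v) w - delta R (u ++ y :: x :: v) w
      - Phi x y * delta R (u ++ v) w).

(* generators of the image of SW_{n-1}: words of length <= n-1 (none if n=0) *)
Definition low_words (R : comPzRingType) (M : lmodType R) (n : nat)
    (g : seq M -> R) : Prop :=
  exists w : seq M, (size w < n)%N /\ g =1 delta R w.

(* words of length <= n : generators of SW_n *)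
Definition upto_words (R : comPzRingType) (M : lmodType R) (n : nat)
    (g : seq M -> R) : Prop :=
  exists w : seq M, (size w <= n)%N /\ g =1 delta R w.

Definition deg_words (R : comPzRingType) (M : lmodType R) (n : nat)
    (g : seq M -> R) : Prop :=
  exists w : seq M, size w = n /\ g =1 delta R w.

(* S^n(M) = F(M^n) / (multilinearity + symmetry relations) *)
Definition sym_rel (R : comPzRingType) (M : lmodType R) (n : nat)
    (g : seq M -> R) : Prop :=
  tensor_rel (fun u v => (size u + size v).+1 = n) g
  \/ (exists (u v : seq M) (x y : M), (size u + size v).+2 = n /\ g =1 fun w =>
      delta R (u ++ x :: y :: v) w - delta R (u ++ y :: x :: v) w).

(* Main.v *)
Require Import Defs.
From HB Require Import structures.
From mathcomp Require Import all_boot all_order all_algebra.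
From mathcomp Require Import generic_quotient ring_quotient.
From mathcomp Require Import boolp functions.
(**
If [Phi x y = B x y - B y x] for a bilinear form [B], then [x] acts on the
symmetric algebra as multiplication by [x] plus the derivation extending
[B x], and these operators satisfy the relations of [SW(M)].  A word applied
to [1] is the commutative product of its letters plus terms of lower degree,
so its leading term is recovered from its class in [SW(M)].

On a free module such a [B] exists: take the strictly upper triangular part of
the alternating form.  For flat [M], a relation in [SW_n(M)/SW_{n-1}(M)]
involves finitely many elements of [M] and finitely many linear relations
between them; by the equational criterion of flatness all of these lift to a
finite free module, on which [Phi] is pulled back, and the relation obtained
there in the symmetric power is pushed forward to [M].

The operators are used in dual form, on functionals defined on words, which
avoids extending them linearly to the free module on words.
*)
Set Implicit Arguments. Unset Strict Implicit. Unset Printing Implicit Defensive.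
Import GRing.Theory.
Local Open Scope ring_scope.
Local Open Scope quotient_scope.

(** * Quotients and submodules of modules, cut out by propositional predicates *)

Definition submodule (R : pzRingType) (V : lmodType R) (P : V -> Prop) : Prop :=
  P 0 /\ forall r u v, P u -> P v -> P (r *: u + v).

Section Submodules.
Variables (R : pzRingType) (V : lmodType R) (P : V -> Prop).
Hypothesis subP : submodule P.

Let pP : {pred V} := fun v => `[< P v >].

Let pP_closed : submod_closed pP.
Proof.
case: subP => P0 PL; split=> [|r u v /asboolP Pu /asboolP Pv]; apply/asboolP => //.
exact: PL.
Qed.

HB.instance Definition _ := GRing.isSubmodClosed.Build R V pP pP_closed.

Let Q := Quotient.quot pP.
HB.instance Definition _ := GRing.Zmodule.on Q.

Let qscale (r : R) (q : Q) : Q := \pi_Q (r *: repr q).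

Let pi_eq (u v : V) : (\pi_Q u == \pi_Q v) = (u - v \in pP).
Proof. by rewrite Quotient.idealrBE. Qed.

Let qscaleE r v : qscale r (\pi_Q v) = \pi_Q (r *: v).
Proof.
by apply/eqP; rewrite /qscale pi_eq -scalerBr rpredZ // -pi_eq reprK.
Qed.

Let piD (u v : V) : \pi_Q (u + v) = \pi_Q u + \pi_Q v.
Proof. exact: raddfD. Qed.

Let qP (q : Q) : exists v, q = \pi_Q v.
Proof. by exists (repr q); rewrite reprK. Qed.

Let qscaleA a b q : qscale a (qscale b q) = qscale (a * b) q.
Proof. by case: (qP q) => v ->; rewrite !qscaleE scalerA. Qed.
Let qscale1 : left_id 1 qscale.
Proof. by move=> q; case: (qP q) => v ->; rewrite qscaleE scale1r. Qed.
Let qscaleDr : right_distributive qscale +%R.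
Proof.
move=> a q q'; case: (qP q) (qP q') => u -> [v ->].
by rewrite -piD !qscaleE scalerDr piD.
Qed.
Let qscaleDl v : {morph qscale^~ v : a b / a + b}.
Proof. by case: (qP v) => u -> a b; rewrite !qscaleE scalerDl piD. Qed.

HB.instance Definition _ :=
  GRing.Zmodule_isLmodule.Build R Q qscaleA qscale1 qscaleDr qscaleDl.

Let pi_linear : linear (\pi_Q : V -> Q).
Proof. by move=> r u v; rewrite piD -qscaleE. Qed.

HB.instance Definition _ := GRing.isLinear.Build R V Q *:%R (\pi_Q : V -> Q) pi_linear.

(** Trades membership in a submodule of relations for the vanishing of a linear map, so that later
    arguments compute in a module. *)
Lemma quotient_lmod :
  exists (W : lmodType R) (pi : {linear V -> W}), forall v, pi v = 0 <-> P v.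
Proof.
exists Q, (\pi_Q : V -> Q) => v; rewrite -(raddf0 (\pi_Q : V -> Q)).
split=> [/eqP|Pv]; first by rewrite pi_eq subr0 => /asboolP.
by apply/eqP; rewrite pi_eq subr0; apply/asboolP.
Qed.

Let U := {v : V | v \in pP}.
HB.instance Definition _ := SubChoice.on U.
HB.instance Definition _ := [SubChoice_isSubLmodule of U by <:].

Lemma sub_lmod :
  exists (U : lmodType R) (f : {linear U -> V}),
    injective f /\ forall v, P v <-> exists u, f u = v.
Proof.
exists U, (val : U -> V); split=> [|v]; first exact: val_inj.
split=> [Pv|[u <-]]; last exact/asboolP/(valP u).
have pv : v \in pP by apply/asboolP.
by exists (exist _ v pv).
Qed.

End Submodules.

(** * Spans of generators *)

Section Span.
Variables (R : pzRingType) (X : Type).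
Implicit Types (G : (X -> R) -> Prop) (c : X -> R).

Lemma in_span_ext G c c' : c =1 c' -> in_span G c -> in_span G c'.
Proof.
by move=> cc' [k [a [g [Gg cE]]]]; exists k, a, g; split=> // x; rewrite -cc'.
Qed.

Lemma in_span_gen G c : G c -> in_span G c.
Proof.
move=> Gc; exists 1%N, (fun=> 1), (fun=> c); split=> // x.
by rewrite big_ord1 mul1r.
Qed.

Lemma in_span_submodule G :
  submodule (in_span G : (X -> (R^o : lmodType R)) -> Prop).
Proof.
split=> [|r u v [k [a [g [Gg uE]]]] [l [b [h [Gh vE]]]]].
  by exists 0%N, (fun=> 0), (fun=> 0); split=> [[]|x]; rewrite ?big_ord0.
exists (k + l)%N, (fun i => match fintype.split i with inl j => r * a j | inr j => b j end).
exists (fun i => match fintype.split i with inl j => g j | inr j => h j end).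
split=> [i|x]; first by case: (fintype.split i).
rewrite big_split_ord /= -[LHS]/(r * u x + v x) uE vE mulr_sumr; congr (_ + _).
  by apply: eq_bigr => i _; rewrite (unsplitK (inl i)) mulrA.
by apply: eq_bigr => i _; rewrite (unsplitK (inr i)).
Qed.

Lemma in_span_lin G r c d :
  in_span G c -> in_span G d -> in_span G (fun x => r * c x + d x).
Proof. exact: (in_span_submodule G).2. Qed.

Lemma in_span_sum G I (s : seq I) (P : pred I) (a : I -> R) (g : I -> X -> R) :
  (forall i, P i -> in_span G (g i)) ->
  in_span G (fun x => \sum_(i <- s | P i) a i * g i x).
Proof.
move=> Gg; elim: s => [|i s IH].
  by apply: in_span_ext (in_span_submodule G).1 => x; rewrite big_nil.
case Pi: (P i); last by apply: in_span_ext IH => x; rewrite big_cons Pi.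
apply: in_span_ext (in_span_lin (a i) (Gg i Pi) IH) => x.
by rewrite big_cons Pi.
Qed.

Lemma in_span_sub G G' c :
  (forall g, G g -> in_span G' g) -> in_span G c -> in_span G' c.
Proof.
move=> GG' [k [a [g [Gg cE]]]].
by apply: in_span_ext (fun x => esym (cE x)) _; apply: in_span_sum => i _; apply: GG'.
Qed.

End Span.

(** * Formal sums and linear maps out of free modules *)

Section FormalSums.
Variables (R : comPzRingType) (X : eqType).
Implicit Types (s : seq (R * X)).

(** Functions [X -> R] may have infinite support; lists of pairs present those of finite support, on
    which a linear extension can be computed. *)
Definition fsum s : X -> R := fun x => \sum_(p <- s) p.1 * delta R p.2 x.

Definition eval (V : lmodType R) (h : X -> V) s : V :=
  \sum_(p <- s) p.1 *: h p.2.

Lemma eval_supp (V : lmodType R) (h : X -> V) s T :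
  uniq T -> {subset unzip2 s <= T} ->
  eval h s = \sum_(x <- T) fsum s x *: h x.
Proof.
move=> uT sT; under [RHS]eq_bigr do rewrite /fsum scaler_suml.
rewrite exchange_big; apply: eq_big_seq => p ps /=.
have pT : p.2 \in T by apply/sT/map_f.
rewrite (bigD1_seq p.2) //= /delta eqxx mulr1 big1 ?addr0 // => x /negPf ->.
by rewrite mulr0 scale0r.
Qed.

(* Well-definedness of the linear extension of [h] to the free module. *)
Lemma eval_comb (V : lmodType R) (h : X -> V) s k (a : 'I_k -> R)
    (g : 'I_k -> X -> R) (t : 'I_k -> seq (R * X)) :
  (forall x, fsum s x = \sum_(i < k) a i * g i x) ->
  (forall i, g i =1 fsum (t i)) ->
  eval h s = \sum_(i < k) a i *: eval h (t i).
Proof.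
move=> sE gE.
pose T := undup (unzip2 s ++ flatten [seq unzip2 (t i) | i : 'I_k]).
have uT : uniq T by apply: undup_uniq.
rewrite (eval_supp h uT); last by move=> x xs; rewrite mem_undup mem_cat xs.
under eq_bigr do rewrite sE scaler_suml.
rewrite exchange_big; apply: eq_bigr => i _ /=.
rewrite (eval_supp h uT); last first.
  move=> x xt; rewrite mem_undup mem_cat; apply/orP; right.
  by apply/flattenP; exists (unzip2 (t i)) => //; apply: image_f.
by rewrite scaler_sumr; apply: eq_bigr => x _; rewrite gE scalerA.
Qed.

(** The universal property of the quotient by [G]: it suffices that [h] kills each generator, in one
    presentation of it. *)
Lemma eval_span (V : lmodType R) (h : X -> V) (G : (X -> R) -> Prop) s :
  (forall g, G g -> exists2 t, g =1 fsum t & eval h t = 0) ->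
  in_span G (fsum s) -> eval h s = 0.
Proof.
move=> GE [k [a [g [Gg sE]]]].
have [t tE] := fin_all_exists2 (fun i => GE _ (Gg i)).
by move=> t0; rewrite (eval_comb h sE tE) big1 // => i _; rewrite t0 scaler0.
Qed.

Lemma comb_fsum k (a : 'I_k -> R) (p : 'I_k -> X) :
  comb a p =1 fsum [seq (a i, p i) | i <- enum 'I_k].
Proof. by move=> x; rewrite /fsum big_map big_enum. Qed.

Lemma eval_comb_seq (V : lmodType R) (h : X -> V) k (a : 'I_k -> R) (p : 'I_k -> X) :
  eval h [seq (a i, p i) | i <- enum 'I_k] = \sum_(i < k) a i *: h (p i).
Proof. by rewrite /eval big_map big_enum. Qed.

(** The quotient is taken of all functions, not only the finitely supported ones; this is harmless,
    as only formal sums are tested. *)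
Lemma span_presentation (G : (X -> R) -> Prop) :
  exists (W : lmodType R) (h : X -> W),
    forall s, eval h s = 0 <-> in_span G (fsum s).
Proof.
have [W [pi piE]] := quotient_lmod (in_span_submodule G).
exists W, (fun x => pi (delta R x)) => s; rewrite -piE.
suff -> : pi (fsum s) = eval (fun x => pi (delta R x)) s by [].
rewrite /eval; under eq_bigr do rewrite -linearZ.
rewrite -linear_sum; congr (pi _); apply/funext => x.
by rewrite fct_sumE.
Qed.

End FormalSums.

(** * The action of the Weyl algebra on the symmetric algebra, in dual form *)

Section WeylAction.
Variables (R : comPzRingType) (N : lmodType R) (W : lmodType R).
Variable B : N -> N -> R.
Hypothesis BLl : forall r x y z, B (r *: x + y) z = r * B x z + B y z.
Hypothesis BLr : forall r x y z, B z (r *: x + y) = r * B z x + B z y.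
Implicit Types (lam : seq N -> W) (u v w : seq N).

Definition multilinear lam := forall u v r x y,
  lam (u ++ (r *: x + y) :: v) = r *: lam (u ++ x :: v) + lam (u ++ y :: v).

Definition symmetric_words lam := forall u v x y,
  lam (u ++ x :: y :: v) = lam (u ++ y :: x :: v).

(* For [lam] a functional on words, [contract x lam] is [lam] composed with the
   derivation of the symmetric algebra sending a letter [y] to [B x y]. *)
Fixpoint contract x lam w : W :=
  if w is y :: w' then B x y *: lam w' + contract x (fun v => lam (y :: v)) w'
  else 0.

(** The transpose of the operator of [x]: multiplication by [x] plus the derivation extending
    [B x]. *)
Definition act x lam w := lam (x :: w) + contract x lam w.

(** The value of [lam] on the result of letting [w] act on 1; the first letter of [w] acts last. *)
Fixpoint psi lam w : W := if w is x :: w' then psi (act x lam) w' else lam [::].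

Lemma contract_lin x lam lam1 lam2 r w :
  (forall v, lam v = r *: lam1 v + lam2 v) ->
  contract x lam w = r *: contract x lam1 w + contract x lam2 w.
Proof.
elim: w lam lam1 lam2 => [|y w IH] lam lam1 lam2 lamE /=; first by rewrite scaler0 addr0.
rewrite lamE (IH _ (fun v => lam1 (y :: v)) (fun v => lam2 (y :: v))) //.
by rewrite !scalerDr !scalerA mulrC addrACA.
Qed.

Lemma act_lin x lam lam1 lam2 r w :
  (forall v, lam v = r *: lam1 v + lam2 v) ->
  act x lam w = r *: act x lam1 w + act x lam2 w.
Proof.
by move=> lamE; rewrite /act lamE (contract_lin _ _ lamE) scalerDr addrACA.
Qed.

Lemma psi_lin lam lam1 lam2 r w :
  (forall v, lam v = r *: lam1 v + lam2 v) ->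
  psi lam w = r *: psi lam1 w + psi lam2 w.
Proof.
elim: w lam lam1 lam2 => [|x w IH] lam lam1 lam2 lamE //=.
by apply: IH => v; apply: act_lin.
Qed.

Lemma eq_contract x lam lam' w : lam =1 lam' -> contract x lam w = contract x lam' w.
Proof.
by elim: w lam lam' => //= y w IH lam lam' E; rewrite E (IH _ _ (fun v => E _)).
Qed.

Lemma multilinear_cons x lam : multilinear lam -> multilinear (fun v => lam (x :: v)).
Proof. by move=> lamL u v r y z; rewrite -!cat_cons lamL. Qed.

Lemma symmetric_cons x lam :
  symmetric_words lam -> symmetric_words (fun v => lam (x :: v)).
Proof. by move=> lamS u v y z; rewrite -!cat_cons lamS. Qed.

Lemma contract_multilinear x lam : multilinear lam -> multilinear (contract x lam).
Proof.
move=> lamL u v r y z; elim: u lam lamL => [|a u IH] lam lamL /=.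
  rewrite (contract_lin _ _ (lam1 := fun v => lam (y :: v))
    (lam2 := fun v => lam (z :: v)) (r := r)); last by move=> w; apply: (lamL [::]).
  by rewrite BLr scalerDl -scalerA scalerDr addrACA.
rewrite lamL (IH (fun v => lam (a :: v))); last exact: multilinear_cons.
by rewrite !scalerDr !scalerA mulrC addrACA.
Qed.

Lemma contract_symmetric x lam :
  symmetric_words lam -> symmetric_words (contract x lam).
Proof.
move=> lamS u v y z; elim: u lam lamS => [|a u IH] lam lamS /=.
  by rewrite addrCA; do 2![congr (_ + _)]; apply: eq_contract => w; apply: (lamS [::]).
by rewrite lamS (IH (fun v => lam (a :: v))) //; apply: symmetric_cons.
Qed.

Lemma act_multilinear x lam : multilinear lam -> multilinear (act x lam).
Proof.
move=> lamL u v r y z; rewrite /act -!cat_cons lamL contract_multilinear //.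
by rewrite scalerDr addrACA.
Qed.

Lemma act_symmetric x lam : symmetric_words lam -> symmetric_words (act x lam).
Proof.
by move=> lamS u v y z; rewrite /act -!cat_cons lamS contract_symmetric.
Qed.

Lemma contract_linl lam r x y w :
  contract (r *: x + y) lam w = r *: contract x lam w + contract y lam w.
Proof.
elim: w lam => [|z w IH] lam /=; first by rewrite scaler0 addr0.
by rewrite BLl IH scalerDl -scalerA scalerDr addrACA.
Qed.

Lemma act_linl lam r x y w : multilinear lam ->
  act (r *: x + y) lam w = r *: act x lam w + act y lam w.
Proof.
by move=> lamL; rewrite /act contract_linl (lamL [::]) scalerDr addrACA.
Qed.

(** Both sides remove two letters, pairing one with [x] and the other with [y], and sum over all
    such choices. *)
Lemma contractC lam x y w :
  contract y (contract x lam) w = contract x (contract y lam) w.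
Proof.
elim: w lam => [|z w IH] lam //=.
rewrite (@contract_lin y _ lam (contract x (fun v => lam (z :: v))) (B x z)) //.
rewrite [in RHS](@contract_lin x _ lam (contract y (fun v => lam (z :: v))) (B y z)) //.
by rewrite IH addrCA.
Qed.

Lemma act_comm lam x y w : symmetric_words lam ->
  act y (act x lam) w =
  (B x y - B y x) *: lam w + act x (act y lam) w.
Proof.
move=> lamS.
(* The scalar comes from the derivation of [a] hitting the new letter [b]. The other terms are
   symmetric in [a] and [b], because letters commute under [lam] and contractions commute. *)
have actE a b : act b (act a lam) w = B a b *: lam w
    + (lam (a :: b :: w) + contract b (contract a lam) w
       + (contract a (fun v => lam (b :: v)) w + contract b (fun v => lam (a :: v)) w)).
  rewrite {1}/act.
  rewrite (@contract_lin b _ (fun v => lam (a :: v)) (contract a lam) 1);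
    last by move=> v; rewrite scale1r.
  rewrite scale1r /act /=; set p := lam _; set q := B a b *: _.
  set c := contract a _ w; set d := contract b _ w; set e := contract b _ w.
  rewrite [p + _]addrCA -addrA; congr (q + _).
  by rewrite [d + e]addrC addrACA.
rewrite !actE contractC (lamS [::]) [contract y _ w + _]addrC [RHS]addrA; congr (_ + _).
by rewrite -scalerDl subrK.
Qed.

Lemma psi_multilinear lam : multilinear lam -> multilinear (psi lam).
Proof.
move=> lamL u v r x y; elim: u lam lamL => [|a u IH] lam lamL /=.
  by apply: psi_lin => w; apply: act_linl.
exact/IH/act_multilinear.
Qed.

Lemma psi_comm lam u v x y : symmetric_words lam ->
  psi lam (u ++ x :: y :: v) =
  (B x y - B y x) *: psi lam (u ++ v) + psi lam (u ++ y :: x :: v).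
Proof.
elim: u lam => [|a u IH] lam lamS /=; last exact/IH/act_symmetric.
by apply: psi_lin => w; apply: act_comm.
Qed.

(** Contraction removes one letter, so on [w] only values of [lam] on words shorter than [n]
    occur. *)
Lemma contract_low lam x w n :
  (forall v, (size v < n)%N -> lam v = 0) -> (size w <= n)%N ->
  contract x lam w = 0.
Proof.
elim: w lam n => [|y w IH] lam [|n] lam0 //= wn; rewrite lam0 // scaler0 add0r.
by apply: (IH _ n) => // v vn; apply: lam0.
Qed.

(* The word [w] acts on [1] as the commutative product of its letters plus
   terms of lower degree. *)
Lemma psi_leading lam w n :
  (forall v, (size v < n)%N -> lam v = 0) -> (size w <= n)%N -> psi lam w = lam w.
Proof.
elim: w lam n => [|x w IH] lam [|n] lam0 //= wn.
rewrite (IH _ n) // /act ?(@contract_low _ _ _ n.+1) ?addr0 //; first exact: leqW.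
move=> v vn; rewrite lam0 ?ltnS // add0r.
by apply: (@contract_low _ _ _ n.+1) => //; rewrite ltnW // ltnW.
Qed.

End WeylAction.

(** * Two- and three-term relations in a presented module *)

Section Relations.
Variables (R : comPzRingType) (X : eqType).

Lemma fsum3 (a b c : X) (r : R) :
  fsum [:: (1, a); (-1, b); (- r, c)] =1
  (fun x => delta R a x - delta R b x - r * delta R c x).
Proof. by move=> x; rewrite /fsum !big_cons big_nil /= addr0 mul1r mulN1r mulNr addrA. Qed.

Lemma fsum2 (a b : X) (r : R) :
  fsum [:: (1, a); (- r, b)] =1 (fun x => delta R a x - r * delta R b x).
Proof. by move=> x; rewrite /fsum !big_cons big_nil /= addr0 mul1r mulNr. Qed.

Lemma fsum1 (a : X) : fsum [:: (1 : R, a)] =1 delta R a.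
Proof. by move=> x; rewrite /fsum big_seq1 mul1r. Qed.

Variables (V : lmodType R) (h : X -> V).

Lemma eval3 a b c r : eval h [:: (1, a); (-1, b); (- r, c)] = h a - h b - r *: h c.
Proof. by rewrite /eval !big_cons big_nil addr0 scale1r scaleN1r scaleNr addrA. Qed.

Lemma eval2 a b r : eval h [:: (1, a); (- r, b)] = h a - r *: h b.
Proof. by rewrite /eval !big_cons big_nil addr0 scale1r scaleNr. Qed.

Lemma eval1 a : eval h [:: (1, a)] = h a.
Proof. by rewrite /eval big_seq1 scale1r. Qed.

Variables (G : (X -> R) -> Prop).
Hypothesis hG : forall s, eval h s = 0 <-> in_span G (fsum s).

Lemma presented_add a b c :
  G (fun x => delta R a x - delta R b x - delta R c x) -> h a = h b + h c.
Proof.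
move=> Gabc; have /hG : in_span G (fsum [:: (1, a); (-1, b); (- 1, c)]).
  apply: in_span_ext (in_span_gen Gabc) => x; rewrite fsum3 mul1r //.
by rewrite eval3 scale1r -addrA -opprD => /subr0_eq.
Qed.

Lemma presented_scale a b r :
  G (fun x => delta R a x - r * delta R b x) -> h a = r *: h b.
Proof.
move=> Gab; have /hG : in_span G (fsum [:: (1, a); (- r, b)]).
  by apply: in_span_ext (in_span_gen Gab) => x; rewrite fsum2.
by rewrite eval2 => /subr0_eq.
Qed.

Lemma presented_eq a b : G (fun x => delta R a x - delta R b x) -> h a = h b.
Proof.
move=> Gab; have /hG : in_span G (fsum [:: (1, a); (- 1, b)]).
  by apply: in_span_ext (in_span_gen Gab) => x; rewrite fsum2 mul1r.
by rewrite eval2 scale1r => /subr0_eq.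
Qed.

End Relations.

Lemma submodule_sum (R : pzRingType) (V : lmodType R) (P : V -> Prop)
    (I : Type) (s : seq I) (F : I -> V) :
  submodule P -> (forall i, P (F i)) -> P (\sum_(i <- s) F i).
Proof.
move=> [P0 PL] PF; elim: s => [|i s IH]; rewrite ?big_nil ?big_cons //.
by rewrite -[F i]scale1r; apply: PL.
Qed.

(** * The equational criterion of flatness *)

Section Flatness.
Variables (R : comPzRingType) (M : lmodType R).
Hypothesis Mflat : flat M.

Section OneRelation.
Variables (p : nat) (t : 'I_p -> R).

Definition syzygy (a : 'I_p -> R) := \sum_(j < p) t j * a j = 0.

(* The image of Ker(t) (x) M in M^p, where t : R^p -> R. *)
Definition trivial_relation (v : 'I_p -> M) :=
  exists q (A : 'I_q -> 'I_p -> R) (z : 'I_q -> M),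
    (forall k, syzygy (A k)) /\ forall j, v j = \sum_(k < q) A k j *: z k.

Lemma trivial_relation_submodule : submodule trivial_relation.
Proof.
split=> [|r u v [q1 [A1 [z1 [A1P uE]]]] [q2 [A2 [z2 [A2P vE]]]]].
  by exists 0%N, (fun=> fun=> 0), (fun=> 0); split=> [[]|j]; rewrite ?big_ord0.
exists (q1 + q2)%N, (fun i => match fintype.split i with inl k => A1 k | inr k => A2 k end).
exists (fun i => match fintype.split i with inl k => r *: z1 k | inr k => z2 k end).
split=> [i|j]; first by case: (fintype.split i).
rewrite big_split_ord /= -[LHS]/(r *: u j + v j) uE vE scaler_sumr; congr (_ + _).
  by apply: eq_bigr => i _; rewrite (unsplitK (inl i)) !scalerA mulrC.
by apply: eq_bigr => i _; rewrite (unsplitK (inr i)).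
Qed.

Lemma trivial_relation_gen a m : syzygy a -> trivial_relation (fun j => a j *: m).
Proof.
by move=> aP; exists 1%N, (fun=> a), (fun=> m); split=> // j; rewrite big_ord1.
Qed.

(** Each scalar moves across the tensor sign: [t j] tensor [y j] equals 1 tensor [t j *: y j], and
    these add up to 1 tensor 0. *)
Lemma tensor_relation_zero (y : 'I_p -> M) : \sum_(j < p) t j *: y j = 0 ->
  in_span (@bil_rel R (R^o : lmodType R) M) (comb (fun=> 1) (fun j => (t j : R^o, y j))).
Proof.
move=> ty0; have [W [h hE]] := span_presentation (@bil_rel R (R^o : lmodType R) M).
apply: in_span_ext (fun x => esym (comb_fsum _ _ x)) _.
apply/hE; rewrite eval_comb_seq.
have hD m m' : h (1, m + m') = h (1, m) + h (1, m').
  by apply: (presented_add hE); right; left; exists 1, m, m'.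
have hZ r m : h (1, r *: m) = r *: h (1, m).
  by apply: (presented_scale hE); do 3 right; exists r, 1, m.
have hr r m : h (r, m) = h (1, r *: m).
  rewrite hZ -[in LHS](mulr1 r).
  by apply: (presented_scale hE); do 2 right; left; exists r, 1, m.
have h0 : h (1, 0) = 0 by rewrite -(scale0r 0) hZ scale0r.
under eq_bigr do rewrite scale1r hr.
rewrite -(big_morph (fun m => h (1, m)) hD h0) ty0 //.
Qed.

(** Flatness, applied to the inclusion in [R] of the ideal generated by the [t j], makes the sum of
    the [t j] tensor [y j] vanish already over the ideal. A map from that tensor product to [M^p]
    modulo trivial relations then sends this sum to the class of [y]. *)
Lemma flat_trivial_relation (y : 'I_p -> M) :
  \sum_(j < p) t j *: y j = 0 -> trivial_relation y.
Proof.
move=> /tensor_relation_zero ty0.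
pose I (r : R^o) := exists a : 'I_p -> R, \sum_(j < p) t j * a j = r.
have subI : submodule I.
  split=> [|r _ _ [a <-] [b <-]].
    by exists (fun=> 0); rewrite big1 // => j _; rewrite mulr0.
  exists (fun j => r * a j + b j).
  by rewrite scaler_sumr -big_split; apply: eq_bigr => j _; rewrite mulrDr mulrCA.
have [U [f [f_inj fI]]] := sub_lmod subI.
have /choice [u uE] : forall j, exists v, f v = t j.
  move=> j; apply/fI; exists (fun i => (i == j)%:R).
  rewrite (bigD1 j) //= eqxx mulr1 big1 ?addr0 // => i /negPf ->.
  exact: mulr0.
(* An arbitrary choice of coefficients, not linear in [v]; its defects of linearity are syzygies and
   die in the quotient [W]. *)
have /choice [lift liftE] : forall v, exists a : 'I_p -> R,
    \sum_(j < p) t j * a j = f v.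
  by move=> v; apply/fI; exists v.
have {}ty0 : in_span (@bil_rel R U M) (comb (fun=> 1) (fun j => (u j, y j))).
  apply: (Mflat f_inj); apply: in_span_ext ty0 => x.
  by rewrite /comb; apply: eq_bigr => j _; rewrite uE.
have [W [pi piE]] := quotient_lmod trivial_relation_submodule.
pose h (um : U * M) : W := pi (fun j => lift um.1 j *: um.2).
have piD (v v1 v2 : 'I_p -> M) (r : R) : trivial_relation (fun j => v j - v1 j - r *: v2 j) ->
    pi v - pi v1 - r *: pi v2 = 0.
  by rewrite -linearZ -!linearB => /piE.
have h0 : eval h [seq (1, (u j, y j)) | j <- enum 'I_p] = 0.
  apply: (eval_span (G := @bil_rel R U M)); last first.
    exact: in_span_ext (comb_fsum _ _) ty0.
  have triv0 : trivial_relation (fun=> 0) := trivial_relation_submodule.1.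
  move=> g [|[|[|]]].
  - move=> [n [n' [m gE]]].
    exists [:: (1, (n + n', m)); (-1, (n, m)); (- 1, (n', m))].
      by move=> x; rewrite gE fsum3 mul1r.
    rewrite eval3; apply: piD.
    have := @trivial_relation_gen (fun j => lift (n + n') j - lift n j - lift n' j) m.
    rewrite /syzygy; under eq_bigr do rewrite !mulrBr.
    rewrite !sumrB !liftE linearD -addrA -opprD subrr => /(_ erefl).
    by congr trivial_relation; apply/funext => j; rewrite !scalerBl scale1r.
  - move=> [n [m [m' gE]]].
    exists [:: (1, (n, m + m')); (-1, (n, m)); (- 1, (n, m'))].
      by move=> x; rewrite gE fsum3 mul1r.
    rewrite eval3; apply: piD; apply: eq_ind triv0 _ _; apply/funext => j /=.
    by rewrite scalerDr scale1r -addrA -opprD subrr.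
  - move=> [r [n [m gE]]].
    exists [:: (1, (r *: n, m)); (- r, (n, m))].
      by move=> x; rewrite gE fsum2.
    have := @trivial_relation_gen (fun j => lift (r *: n) j - r * lift n j) m.
    rewrite /syzygy; under eq_bigr do rewrite mulrBr mulrCA.
    rewrite sumrB -mulr_sumr !liftE linearZ subrr => /(_ erefl) /piE.
    rewrite eval2 -[r *: h _]linearZ -linearB /=; congr (pi _ = _).
    by apply/funext => j; rewrite scalerBl -scalerA.
  - move=> [r [n [m gE]]].
    exists [:: (1, (n, r *: m)); (- r, (n, m))].
      by move=> x; rewrite gE fsum2.
    rewrite eval2 -[r *: h _]linearZ -linearB; apply/piE.
    apply: eq_ind triv0 _ _; apply/funext => j /=.
    by rewrite -[RHS]/(lift n j *: (r *: m) - r *: (lift n j *: m)) !scalerA mulrC subrr.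
apply/piE.
(* The first sum is trivial, since the [j]-th basis vector and [lift (u j)] both have image [t j]
   and so differ by a syzygy; the second is the image of the tensor that vanishes. *)
have yE : y = \sum_(j < p) (fun i => ((i == j)%:R - lift (u j) i) *: y j)
    + \sum_(j < p) (fun i => lift (u j) i *: y j).
  rewrite -big_split; apply/funext => i; rewrite fct_sumE (bigD1 i) //= big1 => [|j ji].
    by rewrite addr0 -[RHS]scalerDl subrK eqxx scale1r.
  by rewrite -[LHS]scalerDl subrK eq_sym (negPf ji) scale0r.
rewrite yE linearD (proj2 (piE _)) ?add0r.
  by rewrite linear_sum -[RHS]h0 eval_comb_seq; apply: eq_bigr => j _; rewrite scale1r.
apply: submodule_sum trivial_relation_submodule _ => j; apply: trivial_relation_gen.
rewrite /syzygy; under eq_bigr do rewrite mulrBr.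
rewrite sumrB liftE uE (bigD1 j) //= eqxx mulr1 big1 ?addr0 ?subrr // => i /negPf ->.
exact: mulr0.
Qed.

End OneRelation.

(** Relations are killed one at a time. The lift of [rel] is a vector [t] with zero combination of
    the [y j]; the criterion factors [y] through a matrix annihilated by [t]. Multiplying the lifts
    by this matrix preserves the earlier relations. Only the values of [l] on [S] matter. *)
Lemma flat_lift (S : seq M) (L : seq (seq (R * M))) :
  (forall rel, rel \in L -> {subset unzip2 rel <= S} /\ \sum_(e <- rel) e.1 *: e.2 = 0) ->
  exists p (l : M -> 'rV[R]_p) (y : 'I_p -> M),
    (forall m, m \in S -> \sum_(j < p) l m 0 j *: y j = m) /\
    (forall rel, rel \in L -> \sum_(e <- rel) e.1 *: l e.2 = 0).
Proof.
elim: L => [|rel L IH] LP.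
  (* Without relations, the free module on the positions of [S] serves; [index] sends a repeated
     element to its first position. *)
  exists (size S), (fun m => \row_j (j == index m S :> nat)%:R), (fun j => nth 0 S j).
  split=> // m mS; have im : (index m S < size S)%N by rewrite index_mem.
  rewrite (bigD1 (Ordinal im)) //= mxE eqxx scale1r nth_index // big1 ?addr0 // => j.
  by rewrite -val_eqE mxE /= => /negPf ->; rewrite scale0r.
have [|p [l [y [lS lL]]]] := IH; first by move=> rel' relL; apply: LP; rewrite inE relL orbT.
have [relS rel0] := LP rel (mem_head _ _).
pose t := \sum_(e <- rel) e.1 *: l e.2.
have /flat_trivial_relation [q [A [z [At yE]]]] : \sum_(j < p) t 0 j *: y j = 0.
  rewrite -[RHS]rel0; under eq_bigr do rewrite summxE scaler_suml.
  rewrite exchange_big; apply: eq_big_seq => e er /=.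
  rewrite -[in RHS](lS e.2); last by apply/relS/map_f.
  by rewrite scaler_sumr; apply: eq_bigr => j _; rewrite mxE scalerA.
pose Am : 'M_(p, q) := \matrix_(j, k) A k j.
exists q, (fun m => l m *m Am), z; split=> [m mS|rel'].
  rewrite -[RHS](lS m mS); under eq_bigr do rewrite mxE scaler_suml.
  rewrite exchange_big; apply: eq_bigr => j _ /=; rewrite yE scaler_sumr.
  by apply: eq_bigr => k _; rewrite mxE scalerA.
have E s : \sum_(e <- s) e.1 *: (l e.2 *m Am) = (\sum_(e <- s) e.1 *: l e.2) *m Am.
  by rewrite mulmx_suml; apply: eq_bigr => e _; rewrite scalemxAl.
rewrite inE E => /orP[/eqP->|/lL->]; last by rewrite mul0mx.
apply/rowP => k; rewrite !mxE -[RHS](At k).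
by apply: eq_bigr => j _; rewrite mxE.
Qed.

End Flatness.

(** * Alternating forms, lifting of Weyl relations, and injectivity *)

Section AlternatingForms.
Variables (R : comPzRingType) (M : lmodType R) (Phi : M -> M -> R).
Hypothesis PhiDl : forall x x' y, Phi (x + x') y = Phi x y + Phi x' y.
Hypothesis PhiZl : forall (r : R) x y, Phi (r *: x) y = r * Phi x y.
Hypothesis PhiDr : forall x y y', Phi x (y + y') = Phi x y + Phi x y'.
Hypothesis PhiZr : forall (r : R) x y, Phi x (r *: y) = r * Phi x y.
Hypothesis Phi_alt : forall x, Phi x x = 0.

Lemma alternating_antisym x y : Phi x y = - Phi y x.
Proof.
apply/eqP; rewrite -addr_eq0 -(Phi_alt (x + y)) PhiDl !PhiDr !Phi_alt.
by rewrite add0r addr0.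
Qed.

Section Coordinates.
Variables (p : nat) (y : 'I_p -> M).

Definition lincomb (a : 'rV[R]_p) : M := \sum_(j < p) a 0 j *: y j.

Definition upper_form (a b : 'rV[R]_p) : R :=
  \sum_(i < p) \sum_(j < p)
    a 0 i * b 0 j * (if (i < j)%N then Phi (y i) (y j) else 0).

Lemma lincomb_lin r a b : lincomb (r *: a + b) = r *: lincomb a + lincomb b.
Proof.
rewrite scaler_sumr -big_split; apply: eq_bigr => j _ /=.
by rewrite !mxE scalerDl scalerA.
Qed.

Lemma upper_form_linl r a b c :
  upper_form (r *: a + b) c = r * upper_form a c + upper_form b c.
Proof.
rewrite /upper_form mulr_sumr -big_split; apply: eq_bigr => i _ /=.
rewrite mulr_sumr -big_split; apply: eq_bigr => j _ /=.
by rewrite !mxE !mulrDl !mulrA.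
Qed.

Lemma upper_form_linr r a b c :
  upper_form c (r *: a + b) = r * upper_form c a + upper_form c b.
Proof.
rewrite /upper_form mulr_sumr -big_split; apply: eq_bigr => i _ /=.
rewrite mulr_sumr -big_split; apply: eq_bigr => j _ /=.
by rewrite !mxE mulrDr mulrDl mulrCA !mulrA.
Qed.

(* This is where [Phi_alt] enters: on a free module an alternating form is the
   antisymmetrisation of its strictly upper triangular part. *)
Lemma upper_form_antisym a b :
  upper_form a b - upper_form b a = Phi (lincomb a) (lincomb b).
Proof.
have Phi0l z : Phi 0 z = 0 by rewrite -(scale0r 0) PhiZl mul0r.
have Phi0r z : Phi z 0 = 0 by rewrite -(scale0r 0) PhiZr mul0r.
have -> : Phi (lincomb a) (lincomb b) =
    \sum_(i < p) \sum_(j < p) a 0 i * b 0 j * Phi (y i) (y j).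
  rewrite /lincomb (big_morph (Phi^~ _) (fun x x' => PhiDl x x' _) (Phi0l _)).
  apply: eq_bigr => i _; rewrite (big_morph (Phi _) (PhiDr _) (Phi0r _)).
  by apply: eq_bigr => j _; rewrite PhiZl PhiZr mulrA.
rewrite /upper_form [X in _ - X]exchange_big -sumrB; apply: eq_bigr => i _ /=.
rewrite -sumrB; apply: eq_bigr => j _ /=.
rewrite [b 0 j * _]mulrC -mulrBr; congr (_ * _).
case: ltngtP => [_|_|/val_inj ->]; first by rewrite subr0.
  by rewrite sub0r -alternating_antisym.
by rewrite Phi_alt subr0.
Qed.

End Coordinates.

Lemma multilinear_scale (N W : lmodType R) (lam : seq N -> W) u v r x :
  multilinear lam -> lam (u ++ (r *: x) :: v) = r *: lam (u ++ x :: v).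
Proof.
(* The instance with scalar 1 and both letters 0 shows that [lam] vanishes on a word with a zero
   letter. *)
move=> lamL; have := lamL u v 1 0 0; rewrite scaler0 addr0 scale1r => lam0.
rewrite -[r *: x]addr0 lamL -[RHS]addr0; congr (_ + _).
by apply: (addrI (lam (u ++ 0 :: v))); rewrite addr0 -lam0.
Qed.

(** Such an [h] induces a linear map on [SW/SW_{n-1}] of the free module [R^p], with [Phi] pulled
    back along [lincomb y]. *)
Definition weyl_compatible n p (y : 'I_p -> M) (W : lmodType R)
    (h : seq 'rV[R]_p -> W) : Prop :=
  [/\ multilinear h,
      forall u v a b, h (u ++ a :: b :: v) =
        Phi (lincomb y a) (lincomb y b) *: h (u ++ v) + h (u ++ b :: a :: v)
    & forall w, (size w < n)%N -> h w = 0].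

(* A relation of [SW_n(M)/SW_{n-1}(M)] involves finitely many elements and
   linear relations of [M], hence survives any lift of these to a free module. *)
Lemma weyl_rel_lift n g : weyl_rel Phi g \/ low_words n g ->
  exists SLt : seq M * seq (seq (R * M)) * seq (R * seq M),
  [/\ forall rel, rel \in SLt.1.2 ->
        {subset unzip2 rel <= SLt.1.1} /\ \sum_(e <- rel) e.1 *: e.2 = 0,
      g =1 fsum SLt.2
    & forall p (l : M -> 'rV[R]_p) (y : 'I_p -> M),
      (forall m, m \in SLt.1.1 -> lincomb y (l m) = m) ->
      (forall rel, rel \in SLt.1.2 -> \sum_(e <- rel) e.1 *: l e.2 = 0) ->
      forall (W : lmodType R) (h : seq 'rV[R]_p -> W), weyl_compatible n y h ->
      eval (fun w => h (map l w)) SLt.2 = 0].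
Proof.
case=> [[[|]|]|].
- move=> [u [v [x [z [_ gE]]]]].
  exists ([:: x + z; x; z], [:: [:: (1, x + z); (-1, x); (-1, z)]],
    [:: (1, u ++ (x + z) :: v); (-1, u ++ x :: v); (-1, u ++ z :: v)]).
  split=> [rel|w|p l y _ lL W h [hL _ _]] /=; last 1 first.
  + have := lL _ (mem_head _ _).
    rewrite !big_cons big_nil /= addr0 scale1r !scaleN1r -opprD => /subr0_eq lE.
    rewrite eval3 !map_cat /= lE -[l x]scale1r hL !scale1r.
    by rewrite -addrA -opprD subrr.
  + rewrite inE => /eqP ->; split=> //.
    by rewrite !big_cons big_nil /= addr0 scale1r !scaleN1r -opprD subrr.
  + by rewrite gE fsum3 mul1r.
- move=> [u [v [r [x [_ gE]]]]].
  exists ([:: r *: x; x], [:: [:: (1, r *: x); (- r, x)]],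
    [:: (1, u ++ (r *: x) :: v); (- r, u ++ x :: v)]).
  split=> [rel|w|p l y _ lL W h [hL _ _]] /=; last 1 first.
  + have := lL _ (mem_head _ _).
    rewrite !big_cons big_nil /= addr0 scale1r !scaleNr => /subr0_eq lE.
    by rewrite eval2 !map_cat /= lE multilinear_scale // subrr.
  + rewrite inE => /eqP ->; split=> //.
    by rewrite !big_cons big_nil /= addr0 scale1r !scaleNr subrr.
  + by rewrite gE fsum2.
- move=> [u [v [x [z gE]]]].
  exists ([:: x; z], [::],
    [:: (1, u ++ x :: z :: v); (-1, u ++ z :: x :: v); (- Phi x z, u ++ v)]).
  split=> [//|w|p l y lS _ W h [_ hC _]] /=; first by rewrite gE fsum3.
  rewrite eval3 !map_cat /= hC !lS ?inE ?eqxx ?orbT //.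
  by rewrite addrK subrr.
- move=> [w [wn gE]]; exists ([::], [::], [:: (1, w)]).
  split=> [//|x|p l y _ _ W h [_ _ h0]] /=; first by rewrite gE fsum1.
  by rewrite eval1 h0 // size_map.
Qed.

(** Pulling the universal map to [S^n(M)] back to words in [R^p] and applying [psi] yields a
    functional on the Weyl algebra; by the leading-term lemma it still agrees with the pullback in
    degree [n]. *)
Lemma sym_presentation_compatible n p (y : 'I_p -> M) (W : lmodType R)
    (iota : seq M -> W) :
  (forall s, eval iota s = 0 <-> in_span (@sym_rel R M n) (fsum s)) ->
  exists2 h : seq 'rV[R]_p -> W, weyl_compatible n y h
    & forall w, size w = n -> h w = iota (map (lincomb y) w).
Proof.
move=> iotaE.
(* Multilinearity and symmetry compare words of equal length only, so extension by zero outside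
   degree [n] preserves them. *)
pose lam (w : seq 'rV[R]_p) := if size w == n then iota (map (lincomb y) w) else 0.
have iotaD u v x z : (size u + size v).+1 = n ->
    iota (u ++ (x + z) :: v) = iota (u ++ x :: v) + iota (u ++ z :: v).
  by move=> un; apply: (presented_add iotaE); left; left; exists u, v, x, z.
have iotaZ u v r x : (size u + size v).+1 = n ->
    iota (u ++ (r *: x) :: v) = r *: iota (u ++ x :: v).
  by move=> un; apply: (presented_scale iotaE); left; right; exists u, v, r, x.
have iotaC u v x z : (size u + size v).+2 = n ->
    iota (u ++ x :: z :: v) = iota (u ++ z :: x :: v).
  by move=> un; apply: (presented_eq iotaE); right; exists u, v, x, z.
have lamL : multilinear lam.
  move=> u v r a b; rewrite /lam !size_cat /= addnS.
  case: eqP => un; last by rewrite scaler0 addr0.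
  by rewrite !map_cat /= lincomb_lin iotaD ?iotaZ // !size_map.
have lamS : symmetric_words lam.
  move=> u v a b; rewrite /lam !size_cat /= !addnS.
  by case: eqP => un //; rewrite !map_cat /= iotaC // !size_map.
have lam0 v : (size v < n)%N -> lam v = 0 by rewrite /lam => /ltn_eqF ->.
exists (psi (upper_form y) lam) => [|w wn].
  split=> [|u v a b|w wn].
  - by apply: psi_multilinear => // *; rewrite ?upper_form_linl ?upper_form_linr.
  - rewrite psi_comm // ?upper_form_antisym //.
  - by rewrite (psi_leading _ lam0) ?lam0 // ltnW.
by rewrite (psi_leading _ lam0) ?wn // /lam wn eqxx.
Qed.

Lemma weyl_sym_injective n (s : seq (R * seq M)) : flat M ->
  (forall e, e \in s -> size e.2 = n) ->
  in_span (fun g => weyl_rel Phi g \/ low_words n g) (fsum s) ->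
  in_span (@sym_rel R M n) (fsum s).
Proof.
move=> Mflat sn [k [a [g [Gg sE]]]].
have [W [iota iotaE]] := span_presentation (@sym_rel R M n).
apply/iotaE; have /choice [D DP] := fun i => weyl_rel_lift (Gg i).
(* The letters of [s] are included besides those of the relations, so that lifting a word of [s] and
   mapping it back to [M] returns that word. *)
pose S := flatten (unzip2 s) ++ flatten [seq (D i).1.1 | i : 'I_k].
pose L := flatten [seq (D i).1.2 | i : 'I_k].
have SD i : {subset (D i).1.1 <= S}.
  move=> m mD; rewrite mem_cat; apply/orP; right.
  by apply/flattenP; exists (D i).1.1 => //; apply: image_f.
have LD i : {subset (D i).1.2 <= L}.
  by move=> m mD; apply/flattenP; exists (D i).1.2 => //; apply: image_f.
have [|p [l [y [lS lL]]]] := flat_lift Mflat (S := S) (L := L).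
  move=> rel /flattenP[_ /imageP[i _ ->] relD].
  have [/(_ rel relD)[relS rel0] _ _] := DP i.
  by split=> // m /relS; apply: SD.
have [h hC hn] := sym_presentation_compatible y iotaE.
have -> : eval iota s = eval (fun w => h (map l w)) s.
  apply: eq_big_seq => e es; rewrite hn ?size_map ?sn // -map_comp map_id_in //.
  move=> m me; apply: lS; rewrite mem_cat; apply/orP; left.
  by apply/flattenP; exists e.2 => //; apply: map_f.
have tE i : g i =1 fsum (D i).2 by case: (DP i).
rewrite (eval_comb (fun w => h (map l w)) sE tE) big1 // => i _.
case: (DP i) => _ _ H; rewrite (H _ _ y) ?scaler0 //.
  by move=> m /SD; apply: lS.
by move=> rel /LD; apply: lL.
Qed.

(** A commutation relation in degree [n] is a Weyl relation plus a multiple of a word of length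
    [n - 2]; hence [phi^n] is well defined. *)
Lemma sym_rel_weyl n g : sym_rel n g ->
  in_span (fun g => weyl_rel Phi g \/ low_words n g) g.
Proof.
case=> [[[u [v [x [z [_ gE]]]]]|[u [v [r [x [_ gE]]]]]]|[u [v [x [z [un gE]]]]]].
- by apply: in_span_gen; do 3 left; exists u, v, x, z.
- by apply: in_span_gen; do 2 left; right; exists u, v, r, x.
pose g' w := delta R (u ++ x :: z :: v) w - delta R (u ++ z :: x :: v) w
  - Phi x z * delta R (u ++ v) w.
have g'P : weyl_rel Phi g' by right; exists u, v, x, z.
have low : low_words n (delta R (u ++ v)).
  by exists (u ++ v); split=> //; rewrite size_cat -un leqW.
apply: in_span_ext (in_span_lin (Phi x z) (in_span_gen (or_intror low))
  (in_span_gen (or_introl g'P))) => w.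
by rewrite gE /g' addrC subrK.
Qed.

End AlternatingForms.

Theorem mainTheorem10 (R : comPzRingType) (M : lmodType R) (Phi : M -> M -> R)
  (PhiDl : forall x x' y, Phi (x + x') y = Phi x y + Phi x' y)
  (PhiZl : forall (r : R) x y, Phi (r *: x) y = r * Phi x y)
  (PhiDr : forall x y y', Phi x (y + y') = Phi x y + Phi x y')
  (PhiZr : forall (r : R) x y, Phi x (r *: y) = r * Phi x y)
  (Phi_alt : forall x, Phi x x = 0)
  (Mflat : flat M) (n : nat) :
  (* phi^n is well defined and injective:  for c in F(M^n),
     [c] = 0 in S^n(M)  <->  [c] = 0 in SW_n(M)/SW_{n-1}(M) *)
  (forall c : seq M -> R,
     in_span (@deg_words R M n) c ->
     (in_span (fun g => weyl_rel Phi g \/ @low_words R M n g) c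
      <-> in_span (@sym_rel R M n) c))
  /\
  (* phi^n is surjective *)
  (forall c : seq M -> R, in_span (@upto_words R M n) c ->
     exists c' : seq M -> R, in_span (@deg_words R M n) c' /\
       in_span (fun g => weyl_rel Phi g \/ @low_words R M n g)
               (fun w => c w - c' w)).
Proof.
split=> c [k [a [g [Gg cE]]]].
  split; last exact/in_span_sub/sym_rel_weyl.
  have /choice [w wP] := Gg.
  pose s := [seq (a i, w i) | i <- enum 'I_k].
  have sE : fsum s =1 c.
    move=> x; rewrite -comb_fsum cE; apply: eq_bigr => i _.
    by rewrite (wP i).2.
  move=> cW; apply: (in_span_ext sE).
  apply: weyl_sym_injective (in_span_ext (fun x => esym (sE x)) cW) => //.
  by move=> e /mapP[i _ ->]; apply: (wP i).1.
have /choice [w wP] := Gg.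
(* The terms of length exactly [n] are kept; the discarded ones lie in [SW_{n-1}]. *)
exists (fun x => \sum_(i < k | size (w i) == n) a i * g i x); split.
  apply: in_span_sum => i /eqP wn; apply: in_span_gen; exists (w i).
  by split=> //; exact: (wP i).2.
apply: in_span_ext (in_span_sum (index_enum 'I_k) (P := fun i => size (w i) != n)
  a (g := g) _) => [x|i wn].
  by rewrite cE [X in _ = X - _](bigID (fun i => size (w i) == n)) /= addrAC subrr add0r.
apply: in_span_gen; right; exists (w i); split; last exact: (wP i).2.
by rewrite ltn_neqAle wn (wP i).1.
Qed.
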